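(* Let $(\Omega,\mu)$ be a measure space and let $f$ be a measurable function on $\Omega$. Then $f\in L(\infty,\infty)(\Omega)$ if and only if there exists a constant $C>0$ such that for all $t>0$, $$\int_{t}^{\infty}\lambda_f(s)\,ds\le C\,\lambda_f(t).\qquad( * )$$ Moreover, $$\|f\|_{L(\infty,\infty)}^{\#\#}:=\inf\{C>0:\ ( * )\text{ holds for all }t>0\}=\|f\|_{L(\infty,\infty)}.$$
   Context: Functions are measurable, scalar-valued, finite a.e. For such $f$ on $(\Omega,\mu)$: the distribution function is $\lambda_f(s)=\mu(\{x\in\Omega:|f(x)|>s\})\in[0,\infty]$, $s\ge 0$; the non-increasing rearrangement is $f^*(t)=\inf\{s\ge 0:\lambda_f(s)\le t\}$ for $t>0$ (with $\inf\emptyset=\infty$); and $f^{**}(t)=\frac1t\int_0^t f^*(s)\,ds$. Let $\|f\|_{L(\infty,\infty)}=\sup_{t>0}\{f^{**}(t)-f^*(t)\}$, and let $L(\infty,\infty)(\Omega)$ be the set of $f$ with $\|f\|_{L(\infty,\infty)}<\infty$. The difference is interpreted through the identity $t\,(f^{**}(t)-f^*(t))=\int_{f^*(t)}^\infty\lambda_f(s)\,ds$; in particular it is $0$ when $f^*(t)=\infty$. In $( * )$, $C\cdot\infty=\infty$ for $C>0$. Note that $\|\cdot\|_{L(\infty,\infty)}$ is not claimed to be a norm. By convention the infimum of the empty set is $\infty$. *)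

(* Defs.v *)
From HB Require Import structures.
From mathcomp Require Import all_boot all_order all_algebra.
From mathcomp Require Import all_classical all_reals all_analysis.
From mathcomp Require Import measurable_realfun.

Set Implicit Arguments.
Unset Strict Implicit.
Unset Printing Implicit Defensive.

Import Order.TTheory GRing.Theory Num.Theory.
Import numFieldNormedType.Exports.

Local Open Scope classical_set_scope.
Local Open Scope ring_scope.
Local Open Scope ereal_scope.

(* A scalar function u + iv is represented by its coordinates u and v. They take
   values in \bar R because f is only required to be finite almost everywhere;
   the value of f is infinite as soon as one coordinate is.  A real-valued (or
   extended real-valued) u is the function x |-> (u x, 0). *)
Definition xscalar (R : realType) : Type := (\bar R * \bar R)%type.

Definition xscalar_finite (R : realType) (z : xscalar R) : bool :=
  (z.1 \is a fin_num) && (z.2 \is a fin_num).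

Definition modulus (R : realType) (z : xscalar R) : \bar R :=
  match z with
  | (a%:E, b%:E) => (Num.sqrt (a ^+ 2 + b ^+ 2))%:E
  | _ => +oo
  end.

Lemma modulus_real (R : realType) (x : \bar R) : modulus (x, 0) = `|x|.
Proof.
case: x => [r| |] //=.
by rewrite expr0n addr0 sqrtr_sqr.
Qed.

Section rearrangement.
Context d (T : measurableType d) (R : realType).
Variables (mu : {measure set T -> \bar R}) (f : T -> xscalar R).

Definition scalar_fun : Prop :=
  measurable_fun setT f /\
  {ae mu, forall x, xscalar_finite (f x)}.

Definition distribution_function (s : R) : \bar R :=
  mu [set x | s%:E < modulus (f x)].

(* [ereal_inf set0] is [+oo]; relevant only for [0 < t]. *)
Definition rearrangement (t : R) : \bar R :=
  ereal_inf [set s%:E | s in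
    [set s : R | (0 <= s)%R /\ distribution_function s <= t%:E]].

Definition maximal_rearrangement (t : R) : \bar R :=
  (t^-1)%:E * \int[lebesgue_measure]_(s in `]0%R, t[) rearrangement s.

(* f** - f*, in the sense of
   t (f**(t) - f*(t)) = \int_(f*(t))^oo lambda_f(s) ds.
   When f*(t) is finite the subtraction in \bar R is unambiguous and has this
   value, possibly +oo; when f*(t) = +oo the right-hand side is 0, whereas
   [+oo - +oo] would be [-oo] in \bar R. *)
Definition oscillation (t : R) : \bar R :=
  if rearrangement t == +oo then 0
  else maximal_rearrangement t - rearrangement t.

Definition Linfinf_norm : \bar R :=
  ereal_sup [set oscillation t | t in [set t : R | (0 < t)%R]].

Definition tail_condition (C : R) : Prop :=
  forall t : R, (0 < t)%R ->
    \int[lebesgue_measure]_(s in `]t, +oo[) distribution_function s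
      <= C%:E * distribution_function t.

End rearrangement.

Definition Linfinf d (T : measurableType d) (R : realType)
    (mu : {measure set T -> \bar R}) : set (T -> xscalar R) :=
  [set f | scalar_fun mu f /\ Linfinf_norm mu f < +oo].

Definition Linfinf_sharp_norm d (T : measurableType d) (R : realType)
    (mu : {measure set T -> \bar R}) (f : T -> xscalar R) : \bar R :=
  ereal_inf [set C%:E | C in [set C : R | (0 < C)%R /\ tail_condition mu f C]].

(* Main.v *)
Require Import Defs.
From HB Require Import structures.
From mathcomp Require Import all_boot all_order all_algebra.
From mathcomp Require Import all_classical all_reals all_analysis.
From mathcomp Require Import measurable_realfun.

Set Implicit Arguments.
Unset Strict Implicit.
Unset Printing Implicit Defensive.

Import Order.TTheory GRing.Theory Num.Theory.
Import numFieldNormedType.Exports.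

Local Open Scope classical_set_scope.
Local Open Scope ring_scope.

(** Write lambda for the distribution function of f and f^* for its
    rearrangement; both are non-increasing. The key identity, valid whenever
    t > 0 and y := f^*(t) is finite, is
      f^**(t) - f^*(t) = t^-1 * \int_y^oo lambda(u) du        (oscillationE).
    It is obtained by measuring the planar region
      { (s, u) | 0 < s < t, y < u, s < lambda(u) }
    in two ways: f^* and lambda are generalized inverses of each other, so the
    slice at s has length f^*(s) - y, and the slice at u has length lambda(u)
    because lambda <= t beyond y (integral_rearrangement). In particular the
    oscillation is nonnegative.

    It follows that, for C > 0, the tail condition with constant C says exactly
    that the oscillation is bounded by C (tail_conditionP). Given a bound C on
    the oscillation and s > 0, the inequality at s is trivial when lambda(s) is
    0 or +oo; otherwise t := lambda(s) satisfies f^*(t) <= s, and the tail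
    integral from s is at most the one from f^*(t), which is at most C t.
    Conversely, given the tail condition, every z > f^*(t) has
    \int_z^oo lambda <= C lambda(z) <= C t, and z tends to f^*(t) from above;
    the passage to the limit covers f^*(t) = 0, where the condition itself says
    nothing.

    Both assertions of the theorem are then immediate, the infimum of the
    constants C > 0 above a nonnegative extended real N being N. *)

(** * Monotone functions and slices of planar sets *)

Lemma nonincreasing_emeasurable (R : realType) (g : R -> \bar R) :
  (forall x y : R, x <= y -> (g y <= g x)%E) -> measurable_fun [set: R] g.
Proof.
move=> g_noninc _.
apply: (measurability _ (ErealGenOInfty.measurableE R)) => // _ [_ [a ->] <-].
rewrite setTI; apply: is_interval_measurable => x y /= _.
rewrite !in_itv/= !andbT => gy z /andP[_ zy].
by rewrite in_itv/= andbT (lt_le_trans gy)// g_noninc.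
Qed.

(** Cavalieri's principle: the area of a planar set can be computed from its
    vertical or from its horizontal slices. *)
Lemma lebesgue_section_swap (R : realType) (A : set (R * R)) : measurable A ->
  (\int[lebesgue_measure]_x lebesgue_measure (xsection A x) =
   \int[lebesgue_measure]_y lebesgue_measure (ysection A y) :> \bar R)%E.
Proof.
move=> mA.
exact: (@product_measure_unique _ _ _ _ R lebesgue_measure lebesgue_measure
  (lebesgue_measure \x^ lebesgue_measure)%E
  (@product_measure2E _ _ _ _ _ lebesgue_measure lebesgue_measure) _ mA).
Qed.

(** A set between ]y, z[ and ]y, z] has length z - y; z may be +oo. *)
Lemma lebesgue_measure_sandwich (R : realType) (y : R) (z : \bar R)
    (B : set R) : (y%:E <= z)%E -> measurable B ->
    (forall u, y < u -> (u%:E < z)%E -> B u) ->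
    (forall u, B u -> y < u /\ (u%:E <= z)%E) ->
  (lebesgue_measure B = z - y%:E)%E.
Proof.
move=> yz mB loB upB; apply/eqP; rewrite eq_le; apply/andP; split.
- case: z yz {loB} upB => [z| |]; rewrite ?lee_fin// => yz upB.
    apply: (@le_trans _ _ (lebesgue_measure `]y, z]%classic)).
      apply: le_measure; rewrite ?inE//= => u /upB[yu].
      by rewrite lee_fin /= in_itv/= yu.
    rewrite lebesgue_measure_itv/= lte_fin; case: ltP => // zy.
    by rewrite -EFinB lee_fin subr_ge0.
  by rewrite addye// leey.
- case: z yz loB {upB} => [z| |]; rewrite ?lee_fin// => yz loB.
    apply: (@le_trans _ _ (lebesgue_measure `]y, z[%classic)).
      rewrite lebesgue_measure_itv/= lte_fin; case: ltP => // zy.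
      by rewrite -EFinB lee_fin subr_le0.
    apply: le_measure; rewrite ?inE//= => u.
    by rewrite /= in_itv/= => /andP[yu uz]; apply: loB; rewrite ?lte_fin.
  apply: (@le_trans _ _ (lebesgue_measure `]y, +oo[%classic)).
    by rewrite lebesgue_measure_itv/= ltry.
  apply: le_measure; rewrite ?inE//= => u.
  by rewrite /= in_itv/= andbT => yu; apply: loB; rewrite ?ltry.
Qed.

(** * Distribution function and rearrangement *)

Lemma measurable_modulus (R : realType) :
  measurable_fun [set: xscalar R] (@modulus R).
Proof.
have -> : @modulus R = fun z => if (`|z.1| < +oo)%E && (`|z.2| < +oo)%E
    then (Num.sqrt (fine z.1 ^+ 2 + fine z.2 ^+ 2))%:E else +oo%E.
  by apply/funext => -[[a| |] [b| |]] //=; rewrite ?ltry.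
have m1 : measurable_fun [set: xscalar R] (fun z : xscalar R => z.1).
  exact: measurable_fst.
have m2 : measurable_fun [set: xscalar R] (fun z : xscalar R => z.2).
  exact: measurable_snd.
apply: measurable_fun_ifT => //.
- by apply: measurable_and; apply: measurable_fun_lte => //;
    exact: measurableT_comp.
- apply/measurable_EFinP; apply: measurableT_comp.
    by apply: continuous_measurable_fun; exact: sqrt_continuous.
  apply: measurable_funD; apply: measurable_funX; apply: measurableT_comp => //;
    exact: fine_measurable.
Qed.

Section distribution.
Context d (T : measurableType d) (R : realType).
Variables (mu : {measure set T -> \bar R}) (f : T -> xscalar R).
Hypothesis mf : measurable_fun setT f.

Local Notation lambda := (distribution_function mu f).
Local Notation fstar := (rearrangement mu f).

Lemma measurable_superlevel (s : R) :
  measurable [set x | s%:E < modulus (f x)]%E.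
Proof.
have mg : measurable_fun setT (@modulus R \o f).
  by apply: measurableT_comp => //; exact: measurable_modulus.
by rewrite -[X in measurable X]setTI; exact: emeasurable_fun_o_infty.
Qed.

Lemma distribution_ge0 (s : R) : (0 <= lambda s)%E.
Proof. exact: measure_ge0. Qed.

Lemma distribution_nonincreasing (s s' : R) :
  s <= s' -> (lambda s' <= lambda s)%E.
Proof.
move=> ss'; apply: le_measure; rewrite ?inE; try exact: measurable_superlevel.
by move=> x /=; apply: le_lt_trans; rewrite lee_fin.
Qed.

Lemma measurable_distribution : measurable_fun setT lambda.
Proof.
by apply: nonincreasing_emeasurable; exact: distribution_nonincreasing.
Qed.

Lemma rearrangement_ge0 (t : R) : (0 <= fstar t)%E.
Proof. by apply: le_ereal_inf_tmp => _ [s [s0 _] <-]; rewrite lee_fin. Qed.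

Lemma rearrangement_nonincreasing (s t : R) :
  s <= t -> (fstar t <= fstar s)%E.
Proof.
move=> st; apply: le_ereal_inf_tmp => _ [u [u0 us] <-].
apply: ereal_inf_lbound; exists u => //; split => //.
by apply: (le_trans us); rewrite lee_fin.
Qed.

(** Together with [rearrangement_ge], this says that f^* and lambda are
    generalized inverses of each other. Which of the two inequalities is strict
    is irrelevant up to null sets, so the right-continuity of lambda is not
    needed. *)
Lemma rearrangement_gt (u s : R) :
  0 <= u -> (u%:E < fstar s)%E -> (s%:E < lambda u)%E.
Proof.
move=> u0; apply: contraTT; rewrite -!leNgt => us.
by apply: ereal_inf_lbound; exists u.
Qed.

Lemma rearrangement_ge (u s : R) :
  (s%:E < lambda u)%E -> (u%:E <= fstar s)%E.
Proof.
move=> su; apply: le_ereal_inf_tmp => _ [v [v0 vs] <-].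
rewrite lee_fin leNgt; apply/negP => /ltW /distribution_nonincreasing.
by move=> /(lt_le_trans su) /lt_le_trans /(_ vs); rewrite ltxx.
Qed.

Lemma distribution_le (u t : R) :
  (fstar t < u%:E)%E -> (lambda u <= t%:E)%E.
Proof.
by move=> tu; rewrite leNgt; apply/negP => /rearrangement_ge; rewrite leNgt tu.
Qed.

(** * The oscillation as a tail integral *)

(** The identity t f^**(t) = t f^*(t) + \int_(f^*(t))^oo lambda(u) du, for
    f^*(t) finite. *)
Lemma integral_rearrangement (t y : R) : 0 < t -> fstar t = y%:E ->
  (\int[lebesgue_measure]_(s in `]0%R, t[) fstar s =
   (t * y)%:E + \int[lebesgue_measure]_(u in `]y, +oo[) lambda u)%E.
Proof.
move=> t0 ty.
have y0 : 0 <= y by rewrite -lee_fin -ty rearrangement_ge0.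
have lt_le u : y < u -> (lambda u <= t%:E)%E.
  by move=> yu; apply: distribution_le; rewrite ty lte_fin.
(* The part of the region under lambda lying below t and beyond y. *)
pose A := [set p : R * R | [&& 0 < p.1, p.1 < t, y < p.2 &
                             (p.1%:E < lambda p.2)%E]].
have mA : measurable A.
  have m1 : measurable_fun [set: R * R] (fun p : R * R => p.1).
    exact: measurable_fst.
  have m2 : measurable_fun [set: R * R] (fun p : R * R => p.2).
    exact: measurable_snd.
  have mb : measurable_fun setT (fun p : R * R =>
      [&& 0 < p.1, p.1 < t, y < p.2 & (p.1%:E < lambda p.2)%E]).
    do 3 (apply: measurable_and; first exact: measurable_fun_ltr).
    apply: measurable_fun_lte; first exact/measurable_EFinP.
    by apply: (measurableT_comp measurable_distribution).
  have := mb measurableT [set true] Logic.I; rewrite setTI.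
  by congr measurable; apply/seteqP; split => p /=.
have AE s u : ((s, u) \in A) =
    [&& 0 < s, s < t, y < u & (s%:E < lambda u)%E].
  by apply/idP/idP; rewrite inE.
have xA s : 0 < s < t -> (lebesgue_measure (xsection A s) = fstar s - y%:E)%E.
  move=> /andP[s0 st]; apply: lebesgue_measure_sandwich.
  - by rewrite -ty rearrangement_nonincreasing// ltW.
  - exact: measurable_xsection.
  - move=> u yu us; rewrite /xsection/= AE s0 st yu/=.
    by apply: rearrangement_gt => //; exact: (le_trans y0 (ltW yu)).
  - by move=> u; rewrite /xsection/= AE => /and4P[_ _ yu /rearrangement_ge].
have xA0 s : ~~ (0 < s < t) -> xsection A s = set0.
  move=> st; rewrite -subset0 => u.
  rewrite /xsection/= AE => /and4P[s0 s1 _ _].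
  by rewrite s0 s1 in st.
have yA u : y < u -> lebesgue_measure (ysection A u) = lambda u.
  move=> yu; rewrite -[RHS]sube0; apply: lebesgue_measure_sandwich.
  - exact: distribution_ge0.
  - exact: measurable_ysection.
  - move=> s s0 su; rewrite /ysection/= AE s0 yu su/= andbT.
    by rewrite -lte_fin (lt_le_trans su)// lt_le.
  - by move=> s; rewrite /ysection/= AE => /and4P[s0 _ _ /ltW].
have yA0 u : ~~ (y < u) -> ysection A u = set0.
  move=> yu; rewrite -subset0 => s; rewrite /ysection/= AE => /and4P[_ _ + _].
  by move=> yu'; rewrite yu' in yu.
transitivity (\int[lebesgue_measure]_(s in `]0%R, t[)
    (y%:E + lebesgue_measure (xsection A s)))%E.
  apply: eq_integral => s; rewrite inE/= in_itv/= => st.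
  by rewrite xA// addeC subeK.
rewrite ge0_integralD//=; last first.
  by apply: measurable_funTS; exact: measurable_fun_xsection.
congr (_ + _)%E.
  rewrite integral_cst//= lebesgue_measure_itv/= lte_fin t0 sube0.
  by rewrite -EFinM mulrC.
rewrite integral_mkcond [RHS]integral_mkcond.
transitivity (\int[lebesgue_measure]_s lebesgue_measure (xsection A s))%E.
  apply: eq_integral => s _; rewrite patchE; case: ifPn => //.
  by rewrite notin_setE/= in_itv/= => /negP /xA0 ->; rewrite measure0.
rewrite lebesgue_section_swap//.
apply: eq_integral => u _; rewrite patchE; case: ifPn.
  by rewrite inE/= in_itv/= andbT => /yA.
by rewrite notin_setE/= in_itv/= andbT => /negP /yA0 ->; rewrite measure0.
Qed.

Lemma oscillationE (t y : R) : 0 < t -> fstar t = y%:E ->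
  (oscillation mu f t =
   (t^-1)%:E * \int[lebesgue_measure]_(u in `]y, +oo[) lambda u)%E.
Proof.
move=> t0 ty; rewrite /oscillation ty/= /maximal_rearrangement.
have y0 : 0 <= y by rewrite -lee_fin -ty rearrangement_ge0.
rewrite (integral_rearrangement t0 ty) ge0_muleDr; last 2 first.
- by rewrite lee_fin mulr_ge0// ltW.
- by apply: integral_ge0 => u _; exact: distribution_ge0.
by rewrite -EFinM mulKf ?gt_eqF// addeAC -EFinB subrr add0e.
Qed.

Lemma oscillation_ge0 (t : R) : 0 < t -> (0 <= oscillation mu f t)%E.
Proof.
move=> t0; case ty : (fstar t) (rearrangement_ge0 t) => [y| |] // _.
  rewrite (oscillationE t0 ty); apply: mule_ge0.
    by rewrite lee_fin invr_ge0 ltW.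
  by apply: integral_ge0 => u _; exact: distribution_ge0.
by rewrite /oscillation ty.
Qed.

Lemma Linfinf_norm_ge0 : (0 <= Linfinf_norm mu f)%E.
Proof.
by apply: le_ereal_sup_tmp; exists (oscillation mu f 1);
  [exists 1 => //=|exact: oscillation_ge0].
Qed.

Lemma integral_tail_nonincreasing (s s' : R) : s <= s' ->
  (\int[lebesgue_measure]_(u in `]s', +oo[) lambda u <=
   \int[lebesgue_measure]_(u in `]s, +oo[) lambda u)%E.
Proof.
move=> ss'; apply: ge0_subset_integral => //.
  by apply: measurable_funTS; exact: measurable_distribution.
by move=> u /=; rewrite !in_itv/= !andbT; apply: le_lt_trans.
Qed.

(** * The tail condition as a bound on the oscillation *)

Lemma tail_conditionP (C : R) : 0 < C ->
  tail_condition mu f C <-> (Linfinf_norm mu f <= C%:E)%E.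
Proof.
move=> C0; split => [tailC|normC s s0].
- apply: ge_ereal_sup => _ [t /= t0 <-].
  case ty : (fstar t) (rearrangement_ge0 t) => [y| |] // y0; last first.
    by rewrite /oscillation ty eqxx lee_fin ltW.
  rewrite lee_fin in y0.
  rewrite (oscillationE t0 ty) lee_pdivrMl//.
  have lt_le u : y < u -> (lambda u <= t%:E)%E.
    by move=> yu; apply: distribution_le; rewrite ty lte_fin.
  (* The tail condition is used at z > y, which is positive even if y = 0;
     since lambda <= t on ]y, z], splitting the integral at z costs at most
     t (z - y) = e. *)
  apply/lee_addgt0Pr => e e0.
  pose z := y + e / t.
  have yz : y < z by rewrite ltrDl divr_gt0.
  rewrite (@itv_bndbnd_setU _ _ _ (BRight z))//; last first.
    by rewrite bnd_simp ltW.
  rewrite ge0_integral_setU//=; last 2 first.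
    by apply: measurable_funTS; exact: measurable_distribution.
    rewrite /disj_set; apply/eqP; rewrite -subset0 => u [] /=.
    by rewrite !in_itv/= andbT => /andP[_ uz]; rewrite ltNge uz.
  rewrite addeC; apply: leeD.
    apply: (le_trans (tailC z (le_lt_trans y0 yz))).
    by rewrite muleC lee_pmul2r// ?lt_le// lte_fin.
  apply: (@le_trans _ _ (\int[lebesgue_measure]_(u in `]y, z]) (cst t%:E u))%E).
    apply: ge0_le_integral => //.
      by apply: measurable_funTS; exact: measurable_distribution.
    by move=> u /=; rewrite in_itv/= => /andP[/lt_le].
  rewrite integral_cst//= lebesgue_measure_itv/= lte_fin yz -EFinB -EFinM.
  by rewrite /z addrAC subrr add0r mulrC divfK// gt_eqF.
(* lambda s = +oo, then lambda s = 0, then 0 < lambda s < +oo. *)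
- have [|lamoo] := boolP (lambda s \is a fin_num); last first.
    have -> : lambda s = +oo%E.
      by move: lamoo (distribution_ge0 s); case: (lambda s).
    by rewrite gt0_muley ?lte_fin// leey.
  case lamt : (lambda s) (distribution_ge0 s) => [t| |] // t_ge0 _.
  rewrite lee_fin le_eqVlt in t_ge0; case/predU1P: t_ge0 => [t0|t0].
    rewrite integral0_eq ?lamt -?t0 ?mule0// => u /=.
    rewrite in_itv/= andbT => /ltW /distribution_nonincreasing.
    by rewrite lamt -t0 => u0; apply/le_anti; rewrite u0 distribution_ge0.
  have : (fstar t <= s%:E)%E.
    apply: ereal_inf_lbound; exists s => //.
    by split; [exact: ltW|rewrite lamt].
  case ty : (fstar t) (rearrangement_ge0 t) => [y| |] // _.
  rewrite lee_fin => ys; apply: (le_trans (integral_tail_nonincreasing ys)).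
  rewrite [X in (_ <= X)%E]muleC -lee_pdivrMl// -(oscillationE t0 ty).
  by apply: le_trans normC; apply: ereal_sup_ubound; exists t.
Qed.

End distribution.

Theorem theorem3 (R : realType) (d : measure_display) (T : measurableType d)
    (mu : {measure set T -> \bar R}) (f : T -> xscalar R)
    (hf : scalar_fun mu f) :
  (Linfinf mu f <-> exists C : R, 0 < C /\ tail_condition mu f C) /\
  Linfinf_sharp_norm mu f = Linfinf_norm mu f.
Proof.
have mf := hf.1; split.
- split=> [[_ norm_lty]|[C [C0 /(tail_conditionP mu mf C0) normC]]].
  + pose N := fine (Linfinf_norm mu f).
    have normN : Linfinf_norm mu f = N%:E.
      by rewrite fineK// ge0_fin_numE// (Linfinf_norm_ge0 mu mf).
    have N0 : 0 <= N by rewrite -lee_fin -normN (Linfinf_norm_ge0 mu mf).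
    exists (N + 1); split; first by rewrite ltr_wpDl.
    by apply/tail_conditionP; rewrite ?ltr_wpDl// normN lee_fin lerDl.
  + by split => //; rewrite (le_lt_trans normC)// ltry.
- apply/eqP; rewrite eq_le; apply/andP; split.
  + apply/lee_addgt0Pr => e e0.
    case normN : (Linfinf_norm mu f) (Linfinf_norm_ge0 mu mf) => [N| |] // N0;
      last by rewrite addye// leey.
    rewrite lee_fin in N0.
    apply: ereal_inf_lbound; exists (N + e) => //.
    have Ne0 : 0 < N + e by rewrite ltr_wpDl.
    split => //; apply/tail_conditionP => //.
    by rewrite normN lee_fin lerDl ltW.
  + apply: le_ereal_inf_tmp => _ [C [C0 tailC] <-].
    exact/tail_conditionP.
Qed.
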